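(* Let $n\geq 3$, $m\ge 0$ integers and $\rho>0$. Let $$p(\theta)=\rho+\sum_{k=0}^{m}\big(a_{kn+1}\cos(kn+1)\theta+b_{kn+1}\sin(kn+1)\theta+a_{kn-1}\cos(kn-1)\theta+b_{kn-1}\sin(kn-1)\theta\big)$$ be a real trigonometric polynomial satisfying $p+p''\geq 0$ on $\mathbb{R}$, and let $\mathcal{C}$ be the curve parametrized by $\theta\in[-\pi,\pi]\mapsto\big(p(\theta)\cos\theta-p'(\theta)\sin\theta,\ p(\theta)\sin\theta+p'(\theta)\cos\theta\big)$ (an algebraic rotor of the regular $n$-gon with apothem $\rho$). Assume $\mathcal{C}$ is not a circle and $a_{nm+1}\neq 0$ or $b_{nm+1}\neq 0$. Then the defining polynomial $f\in\mathbb{R}[x,y]$ of $\mathcal{C}$ has total degree $2nm+4$, and $\deg_x(f)=\deg_y(f)=2nm+4$.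
   Context: The defining polynomial of the curve $\mathcal{C}$ is the irreducible polynomial $f\in\mathbb{R}[x,y]$, unique up to a nonzero constant factor, whose zero set is the Zariski closure of $\mathcal{C}$. $\deg_x,\deg_y$ denote partial degrees. *)

(* Defs.v *)
From HB Require Import structures.
From mathcomp Require Import all_boot all_order all_algebra polyXY.
From mathcomp Require Import all_classical all_reals all_analysis.
Set Implicit Arguments. Unset Strict Implicit. Unset Printing Implicit Defensive.
Import Order.TTheory GRing.Theory Num.Theory.
Local Open Scope ring_scope.
Local Open Scope classical_set_scope.

(* Bivariate real polynomials R[x,y] are represented as {poly {poly R}};
   the outer variable is x, the inner one y, and f.[x, y] evaluates f. *)

Definition eval2 (R : realType) (f : {poly {poly R}}) (q : R * R) : R :=
  f.[q.1, q.2].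

Definition degx (R : realType) (f : {poly {poly R}}) : nat := (size f).-1.
Definition degy (R : realType) (f : {poly {poly R}}) : nat := (sizeY f).-1.

(* total degree: max of i + j over the monomials x^i y^j with nonzero
   coefficient (0 for the zero polynomial) *)
Definition totdeg (R : realType) (f : {poly {poly R}}) : nat :=
  \max_(i < size f) \max_(j < size (nth (0%R:{poly R}) f i))
     (if nth (0%R:R) (nth (0%R:{poly R}) f i) j != 0%R then (i + j)%N else 0%N).

Definition irreducible2 (R : realType) (f : {poly {poly R}}) : Prop :=
  f != 0 /\ f \isn't a GRing.unit /\
  forall g h : {poly {poly R}}, f = g * h -> g \is a GRing.unit \/ h \is a GRing.unit.

Definition zariski_closure (R : realType) (S : set (R * R)) : set (R * R) :=
  [set q | forall g : {poly {poly R}},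
             (forall s, S s -> eval2 g s = 0) -> eval2 g q = 0].

Definition defining_poly (R : realType) (S : set (R * R)) (f : {poly {poly R}}) : Prop :=
  irreducible2 f /\ [set q | eval2 f q = 0] = zariski_closure S.

Definition is_circle (R : realType) (S : set (R * R)) : Prop :=
  exists c1 c2 r : R, 0 < r /\
    S = [set q | (q.1 - c1) ^+ 2 + (q.2 - c2) ^+ 2 = r ^+ 2].

(* the trigonometric polynomial
   p(t) = rho + sum_{k=0}^m ( a_{kn+1} cos((kn+1)t) + b_{kn+1} sin((kn+1)t)
                             + a_{kn-1} cos((kn-1)t) + b_{kn-1} sin((kn-1)t) ),
   coefficients indexed by integers (kn-1 = -1 for k = 0). *)
Definition rotor_p (R : realType) (n m : nat) (rho : R) (a b : int -> R) (t : R) : R :=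
  rho + \sum_(k < m.+1)
     (  a ((k * n)%:Z + 1) * cos (((k * n)%:Z + 1)%:~R * t)
      + b ((k * n)%:Z + 1) * sin (((k * n)%:Z + 1)%:~R * t)
      + a ((k * n)%:Z - 1) * cos (((k * n)%:Z - 1)%:~R * t)
      + b ((k * n)%:Z - 1) * sin (((k * n)%:Z - 1)%:~R * t)).

Definition rotor_curve (R : realType) (p : R -> R) : set (R * R) :=
  [set q | exists2 t : R, - pi <= t <= pi &
     q = (p t * cos t - derive1 p t * sin t, p t * sin t + derive1 p t * cos t)].

(* Main.v *)
Require Import Defs.
From HB Require Import structures.
From mathcomp Require Import all_boot all_order all_fingroup all_algebra polyXY.
From mathcomp Require Import separable.
From mathcomp Require Import all_classical all_reals all_analysis.
From mathcomp Require Import complex ring lra zify.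
Set Implicit Arguments. Unset Strict Implicit. Unset Printing Implicit Defensive.
Import Order.TTheory GRing.Theory Num.Theory numFieldNormedType.Exports.
Local Open Scope ring_scope.
Local Open Scope classical_set_scope.
Local Open Scope complex_scope.

(** With u = e^(it), N = nm+1 and e = N+1, the point z = x + iy = (p + ip')u and
    its conjugate w are Laurent polynomials in u: z runs from u^(-(N-1)) to
    u^(N+1), w from u^(-(N+1)) to u^(N-1), with nonzero end coefficients, and the
    coefficient of u in z is rho.

    Upper bound: C[u, 1/u] is free of rank 2e over C[y], and x acts on it by a
    matrix that is affine in y. Its characteristic polynomial is monic of
    degree 2e in x, has total degree at most 2e and vanishes on the curve; so
    does the polynomial F of the real parts of its coefficients.

    Lower bound: the parametrization is generically injective. Indeed, comparing
    the growth of z and w at 0 and infinity shows that z(tu) = z(u) and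
    w(tu) = w(u) force |t| to be bounded. Hence these two equations have no
    common factor over C(t), so only finitely many ratios t occur, and for each
    t different from 1 the coefficient rho of u in z leaves finitely many u.
    Thus a generic horizontal or vertical line meets the complex curve in 2e
    distinct points, and a nonzero polynomial vanishing on the curve has partial
    degrees at least 2e. Dividing by the monic F, such polynomials are the
    multiples of F. *)

Import ComplexField.Normc.

(** * Growth of polynomials at zero and infinity *)

(** Here [up] and [al] stand for |u| and |tu|, and [fu], [fa], [hu], [ha] for the moduli of f and h
    there: z = f/u^k and w = h/u^(k+2) have equal moduli at u and tu. Since z grows like |u|^(k+2)
    at infinity and w like |u|^(-k-2) at 0, points whose ratio is too large cannot agree in both. *)
Lemma ratio_bound (R : realFieldType) (k : nat) (c S r al up fa fu ha hu : R) :
  0 < c -> 0 < S -> 1 <= r -> 0 < al -> 0 < up ->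
  fa * up ^+ k = fu * al ^+ k -> ha * up ^+ k.+2 = hu * al ^+ k.+2 ->
  (1 <= up -> fu <= S * up ^+ (2 * k).+2) -> (up <= 1 -> fu <= S) ->
  (r <= al -> c * al ^+ (2 * k).+2 <= fa) ->
  (1 <= al -> ha <= S * al ^+ (2 * k).+2) -> (al <= 1 -> ha <= S) ->
  (up * r <= 1 -> c <= hu) ->
  al / up <= r ^+ 2 + S * r ^+ (2 * k).+2 / c.
Proof.
move=> c0 S0 r1 al0 up0 ef eh fu1 fu0 fa1 ha1 ha0 hu0.
have r0 : 0 < r by lra.
rewrite leNgt; apply/negP; set t := al / up => tT.
have alE : al = t * up by rewrite /t divfK // gt_eqF.
clearbody t.
have k2 : (2 * k).+2 = (k + k.+2)%N by rewrite mul2n -addnn !addnS.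
have rk1 : 1 <= r ^+ (2 * k).+2 by rewrite exprn_ege1.
have r21 : 1 <= r ^+ 2 by rewrite exprn_ege1.
have Sr0 : 0 < S * r ^+ (2 * k).+2 / c by rewrite divr_gt0 // mulr_gt0 // (lt_le_trans ltr01).
have rr2 : r <= r ^+ 2 by rewrite expr2 ler_peMl // ltW.
have tr : r < t by lra.
have t1 : 1 < t by lra.
have t0 : 0 < t by lra.
have ct : S * r ^+ (2 * k).+2 < c * t by rewrite [ltRHS]mulrC -ltr_pdivrMr //; lra.
have cS : S < c * t.
  by apply: le_lt_trans ct; rewrite ler_peMr // ltW.
have ttk : t <= t ^+ k.+2 by rewrite -[leLHS]expr1 ler_weXn2l // ltW.
have ctk : S * r ^+ (2 * k).+2 < c * t ^+ k.+2.
  by apply: lt_le_trans ct _; rewrite ler_pM2l.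
have cSk : S < c * t ^+ k.+2 by apply: lt_le_trans cS _; rewrite ler_pM2l.
have uk0 j : 0 < up ^+ j by rewrite exprn_gt0.
have ak0 j : 0 < al ^+ j by rewrite exprn_gt0.
have F_fa : r <= al -> c * al ^+ k.+2 * up ^+ k <= fu.
  move=> /fa1 h; rewrite -(ler_pM2r (ak0 k)) -ef.
  by rewrite mulrAC -[c * _ * _]mulrA -exprD addnC -k2 ler_pM2r.
have F_ha : up * r <= 1 -> c * al ^+ k.+2 <= ha * up ^+ k.+2.
  by move=> /hu0 h; rewrite eh ler_pM2r.
(* Both points outside the open unit disk: z alone gives c t^(k+2) <= S. *)
have [up1|up1] := lerP 1 up.
  have ral : r <= al by rewrite alE (le_trans (ltW tr)) // ler_peMr // ltW.
  have := le_trans (F_fa ral) (fu1 up1).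
  rewrite k2 exprD [_ ^+ k * _]mulrC [S * _]mulrA ler_pM2r // alE exprMn [c * _]mulrA ler_pM2r //.
  by rewrite leNgt cSk.
have up1' := ltW up1.
(* Both points in the closed unit disk: w alone gives the same inequality. *)
have [al1|al1] := lerP al 1.
  have ur : up * r <= 1 by rewrite (le_trans _ al1) // alE mulrC ler_pM2r // ltW.
  have := le_trans (F_ha ur) (ler_wpM2r (ltW (uk0 _)) (ha0 al1)).
  by rewrite alE exprMn [c * _]mulrA ler_pM2r // leNgt cSk.
have al1' := ltW al1.
(* Now |u| < 1 < |tu|. If z is large at tu and w at u, multiplying the two estimates gives (ct)^2 <=
   S^2. If only one is large, the other point lies within a factor r of the unit circle, which costs
   r^(2k+2). If neither is, then t < r^2. *)
have [ral|alr] := lerP r al; have [ur|ur] := lerP (up * r) 1.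
- have h1 := le_trans (F_fa ral) (fu0 up1').
  have h2 := le_trans (F_ha ur) (ler_wpM2r (ltW (uk0 _)) (ha1 al1')).
  have {}h2 : c <= S * al ^+ k * up ^+ k.+2.
    rewrite -(ler_pM2r (ak0 k.+2)) (le_trans h2) // k2 exprD.
    by rewrite le_eqVlt; apply/orP; left; apply/eqP; ring.
  have : c * (c * al ^+ k.+2 * up ^+ k) <= S * al ^+ k * up ^+ k.+2 * S.
    by apply: ler_pM => //; apply: ltW => //; apply: (mulr_gt0 (mulr_gt0 c0 (ak0 _)) (uk0 _)).
  rewrite alE !exprMn => h3.
  have {}h3 : c * t * (c * t) * (t ^+ k * up ^+ (2 * k).+2) <= S * S * (t ^+ k * up ^+ (2 * k).+2).
    rewrite k2 exprD; apply: le_trans (le_trans h3 _); rewrite le_eqVlt; apply/orP; left; apply/eqP;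
      rewrite ?(exprS t k.+1) ?(exprS t k); ring.
  move: h3; rewrite ler_pM2r; last by rewrite mulr_gt0 // exprn_gt0 // (lt_trans ltr01).
  by rewrite leNgt ltr_pM // ltW.
- have h1 := le_trans (F_fa ral) (fu0 up1').
  have h2 : c * t ^+ k.+2 <= c * (al * r) ^+ k.+2 * (up * r) ^+ k.
    have h3 : t ^+ k.+2 <= (al * r) ^+ k.+2.
      rewrite lerXn2r // -?topredE /= ?(ltW t0) // ?mulr_ge0 ?ltW //.
      by rewrite alE -mulrA ltr_pMr.
    have h4 : 1 <= (up * r) ^+ k by rewrite exprn_ege1 // ltW.
    rewrite -mulrA ler_pM2l // (le_trans h3) // ler_peMr //.
    exact: le_trans (ltW (exprn_gt0 _ t0)) h3.
  have h3 : c * (al * r) ^+ k.+2 * (up * r) ^+ k = c * al ^+ k.+2 * up ^+ k * r ^+ (2 * k).+2.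
    by rewrite k2 exprD !exprMn; ring.
  move: h2; rewrite h3 leNgt (le_lt_trans _ ctk) // ler_pM2r ?exprn_gt0 //.
- have h2 := le_trans (F_ha ur) (ler_wpM2r (ltW (uk0 _)) (ha1 al1')).
  have h3 : c * t ^+ k.+2 <= S * al ^+ (2 * k).+2.
    by move: h2; rewrite {1}alE exprMn [c * _]mulrA ler_pM2r.
  move: h3; rewrite leNgt (le_lt_trans _ ctk) // ler_pM2l // lerXn2r // -?topredE /= ltW //.
- suff : t < r ^+ 2 by lra.
  rewrite -(ltr_pM2r up0) -alE (lt_trans alr) // expr2 -mulrA ltr_pMr //.
  by rewrite mulrC.
Qed.

Section ComplexNorm.
Variable R : rcfType.
Local Notation C := R[i].
Local Notation nrm := (@normc R).
Implicit Types (x y : C) (f : {poly C}).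

Lemma normc_ge0 x : 0 <= nrm x.
Proof. by rewrite -ler0c (normr_ge0 x). Qed.

Lemma normc_gt0 x : (0 < nrm x) = (x != 0).
Proof. by rewrite -(normr_gt0 x) ltcR. Qed.

Lemma normcX x j : nrm (x ^+ j) = nrm x ^+ j.
Proof.
elim: j => [|j IH]; first by rewrite !expr0 normc1.
by rewrite !exprS normcM IH.
Qed.

Lemma ler_normcD x y : nrm (x + y) <= nrm x + nrm y.
Proof. by rewrite -lecR rmorphD (ler_normD x y). Qed.

Lemma normc_horner_le f : exists2 S : R, 0 < S &
  forall x, nrm x <= 1 -> nrm f.[x] <= S.
Proof.
elim/poly_ind: f => [|f c [S S0 hS]].
  by exists 1 => // x _; rewrite horner0 normc0.
exists (S + nrm c) => [|x x1]; first by rewrite ltr_wpDr // normc_ge0.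
rewrite hornerMXaddC (le_trans (ler_normcD _ _)) // lerD2r normcM.
by rewrite -[S]mulr1 ler_pM ?normc_ge0 ?hS.
Qed.

(** Write f = c + x g with g bounded by S on the unit disk: for small |x| the second term is at most
    half of |c|. *)
Lemma normc_horner_ge f : f`_0 != 0 -> exists2 r : R * R, 0 < r.1 /\ 1 <= r.2 &
  forall x, nrm x * r.2 <= 1 -> r.1 <= nrm f.[x].
Proof.
elim/poly_ind: f => [|f c _]; first by rewrite coef0 eqxx.
rewrite coefD coefMX coefC /= add0r => c0.
have [S S0 hS] := normc_horner_le f.
have nc : 0 < nrm c by rewrite normc_gt0.
exists (nrm c / 2, 1 + 2 * S / nrm c) => /=.
  by rewrite divr_gt0 // lerDl divr_ge0 ?mulr_ge0 ?ltW.
move=> x hx; rewrite hornerMXaddC.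
have x0 := normc_ge0 x.
have x1 : nrm x <= 1.
  apply: le_trans hx; rewrite ler_peMr // lerDl.
  by rewrite divr_ge0 ?mulr_ge0 ?ltW.
have hx2 : nrm x * (2 * S) <= nrm c.
  rewrite -ler_pdivlMr ?mulr_gt0 // -[leRHS]mul1r -ler_pdivrMr ?divr_gt0 ?mulr_gt0 //.
  rewrite invf_div (le_trans _ hx) // ler_wpM2l //; lra.
have h1 : nrm (f.[x] * x) <= S * nrm x.
  by rewrite normcM ler_pM ?normc_ge0 ?hS.
have := ler_normcD (f.[x] * x + c) (- (f.[x] * x)).
have -> : nrm (- (f.[x] * x)) = nrm (f.[x] * x).
  by apply: complexI; rewrite -[LHS]/(`|- (f.[x] * x)|) normrN.
rewrite [_ + c]addrC addrK; lra.
Qed.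

Lemma horner_rev f d x : (size f <= d.+1)%N -> x != 0 ->
  f.[x] = x ^+ d * (\poly_(i < d.+1) f`_(d - i)).[x^-1].
Proof.
move=> sf x0; rewrite horner_poly (horner_coef_wide _ sf) mulr_sumr.
rewrite (reindex_inj rev_ord_inj) /=; apply: eq_bigr => i _.
rewrite subSS; have -> : x ^+ d = x ^+ (d - i) * x ^+ i.
  by rewrite -exprD subnK // -ltnS.
by rewrite exprVn mulrCA mulfK // expf_neq0.
Qed.

(** The estimates at infinity are those at 0 for the reversed polynomial at 1/x, whose constant term
    is the leading coefficient of [f]. *)
Lemma poly_end_bounds f d : f`_0 != 0 -> size f = d.+1 ->
  exists c S r : R, [/\ 0 < c, 0 < S, 1 <= r & forall x, x != 0 ->
  [/\ nrm x <= 1 -> nrm f.[x] <= S, 1 <= nrm x -> nrm f.[x] <= S * nrm x ^+ d,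
     nrm x * r <= 1 -> c <= nrm f.[x] & r <= nrm x -> c * nrm x ^+ d <= nrm f.[x]]].
Proof.
move=> f0 sf; pose g := \poly_(i < d.+1) f`_(d - i).
have g0 : g`_0 != 0.
  rewrite coef_poly subn0; have <- : lead_coef f = f`_d by rewrite lead_coefE sf.
  by rewrite lead_coef_eq0 -size_poly_eq0 sf.
have [S1 S10 hS1] := normc_horner_le f; have [S2 S20 hS2] := normc_horner_le g.
have [[c1 r1] /= [c10 r11] h1] := normc_horner_ge f0.
have [[c2 r2] /= [c20 r21] h2] := normc_horner_ge g0.
exists (Num.min c1 c2), (S1 + S2), (r1 + r2); split; [by rewrite lt_min c10 | lra | lra |].
move=> x x0; have nx0 : 0 < nrm x by rewrite normc_gt0.
have fE : nrm f.[x] = nrm x ^+ d * nrm g.[x^-1].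
  by rewrite (horner_rev (d:=d)) ?sf // normcM normcX.
have nV := normcV x.
split.
- by move=> /hS1; lra.
- move=> x1; rewrite fE mulrC ler_pM2r ?exprn_gt0 //.
  have : nrm x^-1 <= 1 by rewrite nV invf_le1.
  by move=> /hS2; lra.
- move=> hx; apply: le_trans (h1 x _); first by rewrite ge_min lexx.
  by apply: le_trans hx; rewrite ler_pM2l //; lra.
- move=> hx; rewrite fE mulrC ler_pM2l ?exprn_gt0 //.
  apply: le_trans (h2 _ _); first by rewrite ge_min lexx orbT.
  by rewrite nV mulrC ler_pdivrMr // mul1r; lra.
Qed.

Lemma common_ratio_bounded (f h : {poly C}) k :
  f`_0 != 0 -> h`_0 != 0 -> size f = (2 * k).+3 -> size h = (2 * k).+3 ->
  exists T : R, forall t u : C, t != 0 -> u != 0 ->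
    f.[t * u] = t ^+ k * f.[u] -> h.[t * u] = t ^+ k.+2 * h.[u] ->
    nrm t <= T.
Proof.
move=> f0 h0 sf sh.
have [c1 [S1 [r1 [c10 S10 r11 H1]]]] := poly_end_bounds f0 sf.
have [c2 [S2 [r2 [c20 S20 r21 H2]]]] := poly_end_bounds h0 sh.
pose c := Num.min c1 c2; pose S := S1 + S2; pose r := r1 + r2.
have c0 : 0 < c by rewrite lt_min c10.
have S0 : 0 < S by rewrite addr_gt0.
have r1' : 1 <= r by rewrite /r; lra.
have cc1 : c <= c1 by rewrite ge_min lexx.
have cc2 : c <= c2 by rewrite ge_min lexx orbT.
exists (r ^+ 2 + S * r ^+ (2 * k).+2 / c) => t u t0 u0 ef eh.
have tu0 : t * u != 0 by rewrite mulf_neq0.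
have nu0 : 0 < nrm u by rewrite normc_gt0.
have na0 : 0 < nrm (t * u) by rewrite normc_gt0.
have -> : nrm t = nrm (t * u) / nrm u.
  by rewrite normcM mulfK // gt_eqF.
have [F1 F2 _ _] := H1 _ u0; have [_ _ _ F4] := H1 _ tu0.
have [_ _ G3 _] := H2 _ u0; have [G1 G2 _ _] := H2 _ tu0.
apply: (@ratio_bound _ k c S r _ _ (nrm f.[t * u]) (nrm f.[u]) (nrm h.[t * u]) (nrm h.[u])) => //.
- by rewrite -!normcX -!normcM ef; congr nrm; rewrite exprMn; ring.
- by rewrite -!normcX -!normcM eh; congr nrm; rewrite exprMn; ring.
- by move=> /F2 /le_trans -> //; rewrite ler_pM2r ?exprn_gt0 // lerDl ltW.
- by move=> /F1; rewrite /S /r; lra.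
- move=> hx; apply: le_trans (F4 _); last by move: hx; rewrite /r; lra.
  by rewrite ler_pM2r ?exprn_gt0.
- by move=> /G2 /le_trans -> //; rewrite ler_pM2r ?exprn_gt0 // lerDr ltW.
- by move=> /G1; rewrite /S /r; lra.
- move=> hx; apply: le_trans (G3 _) => //; apply: le_trans hx.
  by rewrite ler_pM2l //; rewrite /S /r; lra.
Qed.
End ComplexNorm.

(** * Elimination with total degree control *)

Section TotalDegree.
Variable A : idomainType.
Implicit Types f g : {poly {poly A}}.

(** The subtraction truncates, so coefficients of index above [d] are forced to vanish. *)
Definition totdeg_le (d : nat) f := forall i, (size (f`_i)%R <= d.+1 - i)%N.

Lemma totdeg_leD d f g : totdeg_le d f -> totdeg_le d g -> totdeg_le d (f + g).
Proof.
by move=> hf hg i; rewrite coefD (leq_trans (size_polyD _ _)) // geq_max hf hg.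
Qed.

Lemma totdeg_leN d f : totdeg_le d f -> totdeg_le d (- f).
Proof. by move=> hf i; rewrite coefN size_polyN. Qed.

Lemma totdeg_leM d e f g :
  totdeg_le d f -> totdeg_le e g -> totdeg_le (d + e) (f * g).
Proof.
move=> hf hg i; rewrite coefM (leq_trans (size_sum _ _ _)) //; apply/bigmax_leqP => j _.
have [->|f0] := eqVneq f`_j 0; first by rewrite mul0r size_poly0.
have [->|g0] := eqVneq g`_(i - j) 0; first by rewrite mulr0 size_poly0.
have jd : (j < d.+1)%N by rewrite -subn_gt0 (leq_trans _ (hf j)) // size_poly_gt0.
have ije : (i - j < e.+1)%N by rewrite -subn_gt0 (leq_trans _ (hg _)) // size_poly_gt0.
rewrite size_mul //; have := hf j; have := hg (i - j)%N; have := ltn_ord j.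
move: (size f`_j) (size g`_(i - j)) => m n; clear -jd ije; lia.
Qed.

Lemma totdeg_le_sum (I : Type) (r : seq I) (P : pred I) (F : I -> {poly {poly A}}) d :
  (forall i, P i -> totdeg_le d (F i)) -> totdeg_le d (\sum_(i <- r | P i) F i).
Proof.
move=> h; elim/big_ind: _ => // [i|f g]; last exact: totdeg_leD.
by rewrite coef0 size_poly0.
Qed.

Lemma totdeg_le_prod n (F : 'I_n -> {poly {poly A}}) :
  (forall i, totdeg_le 1 (F i)) -> totdeg_le n (\prod_i F i).
Proof.
elim: n F => [|n IH] F hF.
  by rewrite big_ord0 => -[|i]; rewrite coef1 ?size_poly0 ?size_poly1.
by rewrite big_ord_recl; apply: (@totdeg_leM 1 n) => //; apply: IH.
Qed.

(** Each term of the Leibniz expansion is a product of n entries of total degree at most 1. *)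
Lemma totdeg_le_det n (M : 'M[{poly {poly A}}]_n) :
  (forall i j, totdeg_le 1 (M i j)) -> totdeg_le n (\det M).
Proof.
move=> hM; apply: totdeg_le_sum => s _.
have h : totdeg_le n (\prod_i M i (s i)) by apply: totdeg_le_prod.
by case: (odd_perm s); rewrite ?expr0 ?expr1 ?mul1r // mulN1r; apply: totdeg_leN.
Qed.

Lemma totdeg_le_char_poly n (M : 'M[{poly A}]_n) :
  (forall i j, (size (M i j) <= 2)%N) -> totdeg_le n (char_poly M).
Proof.
move=> hM; apply: totdeg_le_det => i j; rewrite !mxE.
apply: totdeg_leD; last first.
  apply: totdeg_leN => -[|l]; first by rewrite coefC; apply: hM.
  by rewrite coefC size_poly0.
by case: (i == j) => -[|[|l]]; rewrite ?mulr1n ?mulr0n ?coefX ?coef0 /= ?size_poly0 ?size_poly1.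
Qed.
End TotalDegree.

(** * The implicit equation of a Laurent curve *)

Section Elimination.
Variables (F : fieldType) (a b : {poly F}) (e : nat).
Hypotheses (e_gt0 : (0 < e)%N) (b0 : b`_0 != 0) (sb : size b = (2 * e).+1).
Hypothesis sa : (size a <= (2 * e).+1)%N.

(** Divided by X^e, this writes u^i x as -(c + d y), affine in y over the basis 1, ..., u^(2e-1). It
    exists because b(0) != 0 makes X^e and b coprime. *)
Lemma bezout_rel i : (i < 2 * e)%N -> exists c d : {poly F},
  [/\ c * 'X^e + d * b + 'X^i * a = 0, (size c <= 2 * e)%N & (size d <= 2 * e)%N].
Proof.
move=> ie; set T := 'X^i * a.
have bn0 : b != 0 by rewrite -size_poly_eq0 sb.
have : coprimep 'X^e b.
  apply: coprimep_expl; rewrite coprimep_sym -['X]subr0 -polyC0 coprimep_XsubC.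
  by rewrite /root horner_coef0.
case/Bezout_eq1_coprimepP => -[u v] /= uv.
(* Reducing [c] modulo [b] bounds its degree; the quotient moves into [d], whose degree is then read
   off from d b = T - c X^e. *)
set c := (T * u) %% b; set d := T * v + (T * u) %/ b * 'X^e.
have E : c * 'X^e + d * b = T.
  have cE : c = T * u - (T * u) %/ b * b by apply/eqP; rewrite eq_sym subr_eq addrC -divp_eq.
  rewrite -[RHS]mulr1 -uv cE /d; move: ((T * u) %/ b) => q; ring.
have sc : (size c <= 2 * e)%N by rewrite -ltnS -sb ltn_modp.
exists (- c), (- d); split; rewrite ?size_polyN //.
  by rewrite !mulNr -E; ring.
have [->|dn0] := eqVneq d 0; first by rewrite size_poly0.
have : (size (d * b)%R <= 4 * e)%N.
  rewrite (_ : d * b = T - c * 'X^e); last by rewrite -E; ring.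
  rewrite (leq_trans (size_polyD _ _)) // size_polyN geq_max; apply/andP; split.
    apply: (leq_trans (size_polyMleq _ _)); rewrite size_polyXn.
    clear -sa ie; lia.
  apply: (leq_trans (size_polyMleq _ _)); rewrite size_polyXn.
  by rewrite addnS /= (leq_trans (leq_add sc (leqnn e))) //; clear; lia.
by rewrite size_mul // sb addnS /= -[4%N]/(2 + 2)%N mulnDl leq_add2r.
Qed.

(* Multiplication by a/X^e on F[X, 1/X], a free module over F[b/X^e] with
   basis 1, ..., X^(2e-1), has a matrix that is affine in b/X^e; the equation
   is its characteristic polynomial. *)
Lemma implicit_equation : exists f : {poly {poly F}},
  [/\ f \is monic, size f = (2 * e).+1, totdeg_le (2 * e) f &
   forall u, u != 0 -> f.[(a.[u] / u ^+ e)%:P].[b.[u] / u ^+ e] = 0].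
Proof.
have [cd hcd] := fin_all_exists (fun i : 'I_(2 * e) => bezout_rel (ltn_ord i)).
have {hcd}[dd hcd] := fin_all_exists hcd.
(* Column j holds the coordinates of x u^j, with y as the polynomial variable. *)
pose M : 'M[{poly F}]_(2 * e) := \matrix_(i, j) - (((cd j)`_i)%:P + (dd j)`_i *: 'X).
exists (char_poly M); split.
- exact: char_poly_monic.
- exact: size_char_poly.
- apply: totdeg_le_char_poly => i j; rewrite mxE size_polyN.
  rewrite (leq_trans (size_polyD _ _)) // geq_max.
  by rewrite (leq_trans (size_polyC_leq1 _)) // (leq_trans (size_scale_leq _ _)) // size_polyX.
move=> u u0; set x := a.[u] / _; set y := b.[u] / _.
have -> : (char_poly M).[x%:P].[y] = (char_poly (map_mx (horner_eval y) M)).[x].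
  rewrite -map_char_poly -[X in (map_poly _ _).[X]](hornerC x y).
  by rewrite -[(x%:P).[y]]/(horner_eval y x%:P) horner_map.
apply/eqP; rewrite -[_ == 0]/(root _ x) -eigenvalue_root_char; apply/eigenvalueP.
(* The row of powers of u is a left eigenvector of the specialised matrix for the eigenvalue x; its
   entry 1 makes it nonzero. *)
exists (\row_j u ^+ j).
  apply/rowP => j; rewrite !mxE; have [E sc sd] := hcd j.
  have ue0 : u ^+ e != 0 by rewrite expf_neq0.
  have {}E : (cd j).[u] + (dd j).[u] * y + x * u ^+ j = 0.
    apply: (mulIf ue0); rewrite mul0r; transitivity (0.[u] : F); last by rewrite horner0.
    by rewrite -E !hornerE /= /x /y; field.
  have -> : x * u ^+ j = - ((cd j).[u] + (dd j).[u] * y).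
    by apply/eqP; rewrite -addr_eq0 addrC E.
  rewrite opprD.
  rewrite (horner_coef_wide _ sc) (horner_coef_wide _ sd) mulr_suml -!sumrN -big_split /=.
  apply: eq_bigr => i _; rewrite !mxE /horner_eval hornerN hornerD hornerC hornerZ hornerX; ring.
apply/eqP => /rowP H; have e0 : (0 < 2 * e)%N by rewrite muln_gt0.
by have := H (Ordinal e0); rewrite !mxE expr0 => /eqP; rewrite oner_eq0.
Qed.
End Elimination.

(** * Generic injectivity and the degree lower bound *)

(** Source of the generic values chosen below: finitely many bad values are collected as roots of
    one polynomial [q]. *)
Lemma poly_nonroot (F : idomainType) (s : nat -> F) (q : {poly F}) :
  injective s -> q != 0 -> exists n, q.[s n] != 0.
Proof.
move=> injs q0; have [/hasP[n _ hn]|/hasPn h] :=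
  boolP (has (fun n => q.[s n] != 0) (iota 0 (size q))); first by exists n.
have := @max_poly_roots _ _ [seq s n | n <- iota 0 (size q)] q0.
rewrite map_inj_uniq ?iota_uniq // size_map size_iota ltnn => H; exfalso.
suff : false by []; apply: H => //; apply/allP => _ /mapP[n /h hn ->].
by rewrite negbK in hn.
Qed.

Lemma horner2_map (F : comNzRingType) (g : {poly {poly F}}) x y :
  g.[x, y] = (map_poly (horner_eval y) g).[x].
Proof.
by rewrite -[X in _ = _.[X]](hornerC x y) -[(x%:P).[y]]/(horner_eval y x%:P) horner_map.
Qed.

Section Dilation.
Variable F : fieldType.
Implicit Types (f : {poly F}) (t u : F).

(** The polynomial f(tu) - t^j f(u), with u as outer and t as inner variable. Its zeros are the
    pairs for which f/u^j agrees at u and tu, apart from u = 0 or t = 0. *)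
Definition dilation_poly f j : {poly {poly F}} :=
  \poly_(i < size f) (f`_i *: ('X^i - 'X^j)).

Lemma horner_dilation_poly f j t u :
  (dilation_poly f j).[u, t] = f.[t * u] - t ^+ j * f.[u].
Proof.
rewrite horner_poly horner_sum [f.[t * u]]horner_coef [f.[u]]horner_coef.
rewrite mulr_sumr -sumrB; apply: eq_bigr => i _.
rewrite -rmorphXn hornerM hornerC hornerZ hornerD hornerN !hornerXn exprMn; ring.
Qed.

Lemma coef_dilation_poly f j i :
  (dilation_poly f j)`_i = f`_i *: ('X^i - 'X^j).
Proof.
rewrite coef_poly; case: ltnP => // /(nth_default 0) ->.
by rewrite scale0r.
Qed.

Lemma subXn_neq0 i j : i != j -> 'X^i - 'X^j != 0 :> {poly F}.
Proof.
move=> ij; rewrite subr_eq0; apply: contra ij => /eqP /(congr1 (fun p : {poly F} => size p)).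
by rewrite !size_polyXn => -[->].
Qed.

Lemma size_dilation_poly f d j : size f = d.+1 -> d != j -> size (dilation_poly f j) = d.+1.
Proof.
move=> sf dj; rewrite /dilation_poly sf size_poly_eq //.
rewrite scaler_eq0 negb_or subXn_neq0 // andbT.
have <- : lead_coef f = f`_d by rewrite lead_coefE sf.
by rewrite lead_coef_eq0 -size_poly_eq0 sf.
Qed.
End Dilation.

Section GenericInjectivity.
Variable R : rcfType.
Local Notation C := R[i].
Variables (f h : {poly C}) (k : nat).
Hypotheses (k_gt0 : (0 < k)%N) (f0 : f`_0 != 0) (h0 : h`_0 != 0).
Hypotheses (sf : size f = (2 * k).+3) (sh : size h = (2 * k).+3).

(* At a large dilation ratio t the two polynomials in u have no common root by
   [common_ratio_bounded], hence they are coprime over the field C(t). *)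
Lemma dilation_resultant_neq0 :
  resultant (dilation_poly f k) (dilation_poly h k.+2) != 0.
Proof.
rewrite resultant_eq0; apply/negP => sG.
set A := dilation_poly f k in sG; set B := dilation_poly h k.+2 in sG.
set G := gcdp A B in sG.
have [T hT] := common_ratio_bounded f0 h0 sf sh.
have /Pdiv.Idomain.dvdpP[[c1 q1] /= c10 E1] := Pdiv.Idomain.dvdp_gcdl A B.
have /Pdiv.Idomain.dvdpP[[c2 q2] /= c20 E2] := Pdiv.Idomain.dvdp_gcdr A B.
(* Where this constant coefficient is nonzero at t, a common root u cannot be 0. *)
have A0 : A`_0 != 0.
  rewrite coef_dilation_poly scaler_eq0 negb_or f0 subXn_neq0 //.
  by rewrite eq_sym -lt0n.
have G0 : lead_coef G != 0 by rewrite lead_coef_eq0 -size_poly_gt0 (leq_trans _ sG).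
(* Infinitely many ratios beyond the bound [T]; one of them keeps the degree of the gcd and the
   denominators of the pseudo-divisions nonzero. *)
pose s n : C := (`|T| + 1 + n%:R)%:C.
have injs : injective s.
  move=> x y /complexI /addrI /eqP; rewrite eqr_nat => /eqP //.
have [n] := poly_nonroot injs (mulf_neq0 (mulf_neq0 c10 c20) (mulf_neq0 A0 G0)).
rewrite !hornerM !mulf_eq0 !negb_or -!andbA => /and4P[c1t c2t A0t Gt].
set t := s n in c1t c2t A0t Gt.
have tT : normc t = `|T| + 1 + n%:R.
  by rewrite /t /s /= expr0n addr0 sqrtr_sqr ger0_norm ?addr_ge0.
have t0 : t != 0.
  by rewrite -normc_gt0 tT ltr_wpDr // ltr_wpDl.
have sGt : size (map_poly (horner_eval t) G) != 1.
  by rewrite size_map_poly_id0 // neq_ltn sG orbT.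
have /closed_rootP[u] := sGt.
rewrite /root -horner2_map => /eqP Gu.
have Au : A.[u, t] = 0.
  apply: (mulfI c1t); rewrite mulr0 -hornerM -hornerZ E1 hornerM hornerM.
  by rewrite [X in _ * X]Gu mulr0.
have Bu : B.[u, t] = 0.
  apply: (mulfI c2t); rewrite mulr0 -hornerM -hornerZ E2 hornerM hornerM.
  by rewrite [X in _ * X]Gu mulr0.
have u0 : u != 0.
  apply: contraNneq A0t => u0; move: Au; rewrite u0 polyC0 horner_coef0 => ->.
  by rewrite eqxx.
move/eqP: Au; rewrite horner_dilation_poly subr_eq0 => /eqP Au.
move/eqP: Bu; rewrite horner_dilation_poly subr_eq0 => /eqP Bu.
have := hT _ _ t0 u0 Au Bu.
rewrite tT leNgt => /negP; apply.
have := ler_norm T; have := ler0n R n; lra.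
Qed.

(** The ratio t = w/u is a root of the resultant, so it takes finitely many values. For each t other
    than 0 and 1, u is a root of the nonzero polynomial [A] specialised at t; [E] is the product of
    these. *)
Lemma generic_injectivity : f`_k.+1 != 0 -> exists2 E : {poly C}, E != 0 &
  forall u w, u != 0 -> w != 0 -> E.[u] != 0 ->
    f.[w] * u ^+ k = f.[u] * w ^+ k -> h.[w] * u ^+ k.+2 = h.[u] * w ^+ k.+2 ->
    w = u.
Proof.
move=> fk.
have k1 : (2 * k).+2 != k by apply/eqP; clear; lia.
have k2 : (2 * k).+2 != k.+2 by apply/eqP; move: k_gt0; clear; lia.
have [||[U V] _ /= hR] :=
  @resultant_in_ideal _ (dilation_poly f k) (dilation_poly h k.+2).
- by rewrite (size_dilation_poly sf k1).
- by rewrite (size_dilation_poly sh k2).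
move: dilation_resultant_neq0 hR.
set A := dilation_poly f k; set B := dilation_poly h k.+2; set r := resultant A B => r0 hR.
have [rs Ers] := closed_field_poly_normal r.
exists (\prod_(t <- rs | (t != 0) && (t != 1)) map_poly (horner_eval t) A).
  rewrite prodf_seq_neq0; apply/allP => t _; apply/implyP => /andP[t0 t1].
  (* The coefficient of u^(k+1) at t is f_(k+1) t^k (t - 1). *)
  apply/eqP => /(congr1 (fun p : {poly C} => p`_k.+1)).
  rewrite coef0 coef_map coef_dilation_poly /= /horner_eval hornerZ hornerD hornerN !hornerXn.
  apply/eqP; rewrite mulf_neq0 // exprS -{2}[t ^+ k]mul1r -mulrBl mulf_neq0 ?expf_neq0 //.
  by rewrite subr_eq0.
move=> u w u0 w0 Eu ef eh; pose t := w / u.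
have wE : w = t * u by rewrite divfK.
have t0 : t != 0 by rewrite mulf_neq0 ?invr_eq0.
have Au : A.[u, t] = 0.
  apply/eqP; rewrite horner_dilation_poly -wE subr_eq0; apply/eqP.
  apply: (mulIf (expf_neq0 k u0)); rewrite ef wE exprMn; ring.
have Bu : B.[u, t] = 0.
  apply/eqP; rewrite horner_dilation_poly -wE subr_eq0; apply/eqP.
  apply: (mulIf (expf_neq0 k.+2 u0)); rewrite eh wE exprMn; ring.
have rt : root r t.
  have := congr1 (fun p : {poly {poly C}} => p.[u, t]) hR.
  by rewrite /= hornerC hornerD !hornerM hornerD !hornerM Au Bu !mulr0 addr0 => /eqP.
have trs : t \in rs.
  by move: rt; rewrite Ers rootZ ?lead_coef_eq0 // root_prod_XsubC.
have [t1|t1] := eqVneq t 1; first by rewrite wE t1 mul1r.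
case/eqP: Eu; rewrite (big_rem t) //= t0 t1 /= hornerM.
suff -> : (map_poly (horner_eval t) A).[u] = 0 by rewrite mul0r.
by rewrite -horner2_map.
Qed.
End GenericInjectivity.

(** * Counting intersections with a generic line *)

Section DegreeLowerBound.
Variables (C : numClosedFieldType) (a b E : {poly C}) (e : nat).
Hypotheses (e_gt0 : (0 < e)%N) (b0 : b`_0 != 0) (sb : size b = (2 * e).+1) (E0 : E != 0).
Hypothesis injE : forall u w, u != 0 -> w != 0 -> E.[u] != 0 ->
  a.[w] / w ^+ e = a.[u] / u ^+ e -> b.[w] / w ^+ e = b.[u] / u ^+ e -> w = u.

(* A generic horizontal line y = y0 meets the curve in 2e distinct points. *)
Lemma vanishing_size_gt (g : {poly {poly C}}) : g != 0 ->
  (forall u, u != 0 -> g.[a.[u] / u ^+ e, b.[u] / u ^+ e] = 0) ->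
  (2 * e < size g)%N.
Proof.
move=> g0 hg.
(* The derivative of y = b/u^e is K/u^(e+1), so the roots of [K] other than 0 are the critical
   points of y. Its coefficient of index 2e is e times that of [b]. *)
pose K := 'X * b^`() - e%:R *: b.
have lb : b`_(2 * e) != 0.
  have <- : lead_coef b = b`_(2 * e) by rewrite lead_coefE sb.
  by rewrite lead_coef_eq0 -size_poly_eq0 sb.
have K0 : K != 0.
  apply/eqP => /(congr1 (fun p : {poly C} => p`_(2 * e))).
  have [e' ee] : exists e', (2 * e = e'.+1)%N by exists (2 * e).-1; rewrite prednK // muln_gt0.
  rewrite coef0 coefB coefXM coefZ coef_deriv {1 2 3}ee /= -ee mulr_natl -mulrnBr;
    last by rewrite leq_pmull.
  rewrite mul2n -addnn addnK -mulr_natl => /eqP.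
  by rewrite mulf_eq0 pnatr_eq0 gtn_eqF // addnn -mul2n (negPf lb).
have [bad Ebad] := closed_field_poly_normal (E * K).
have EK0 : E * K != 0 by rewrite mulf_neq0.
(* [y0] must keep the leading coefficient of [g] nonzero and avoid the values of y at the bad
   points. If 0 is among them, division by zero assigns it the value 0, which merely excludes y0 =
   0. *)
pose q := lead_coef g * \prod_(u <- bad) ('X - (b.[u] / u ^+ e)%:P).
have q0 : q != 0 by rewrite mulf_neq0 ?lead_coef_eq0 // monic_neq0 // monic_prod_XsubC.
have injn : injective (fun n => n%:R : C) by move=> x y /eqP; rewrite eqr_nat => /eqP.
have [n] := poly_nonroot injn q0; set y0 := n%:R.
rewrite hornerM mulf_eq0 negb_or => /andP[gy0 bady0].
pose P := b - y0 *: 'X^e.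
have sP : size P = (2 * e).+1.
  rewrite size_polyDl ?sb // size_polyN (leq_ltn_trans (size_scale_leq _ _)) // size_polyXn ltnS.
  by rewrite mul2n -addnn -addn1 leq_add2l.
have P0 : P != 0 by rewrite -size_poly_eq0 sP.
have PE u : P.[u] = b.[u] - y0 * u ^+ e by rewrite hornerD hornerN hornerZ hornerXn.
have rootP0 u : root P u -> u != 0.
  apply: contraTneq => ->; rewrite /root PE expr0n gtn_eqF // mulr0 subr0.
  by rewrite horner_coef0.
have rootPy u : root P u -> b.[u] / u ^+ e = y0.
  move=> ru; have u0 := rootP0 _ ru; move: ru; rewrite /root PE subr_eq0 => /eqP ->.
  by rewrite mulfK // expf_neq0.
have rootPgood u : root P u -> (E.[u] != 0) && (K.[u] != 0).
  move=> ru; rewrite -negb_or -mulf_eq0 -hornerM; apply: contra bady0 => EKu.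
  have : u \in bad.
    by rewrite -root_prod_XsubC -(rootZ _ (a := lead_coef (E * K))) ?lead_coef_eq0 // -Ebad.
  by move=> ub; rewrite (big_rem u) //= hornerM hornerXsubC rootPy // subrr mul0r.
have [rs Ers] := closed_field_poly_normal P.
have lP : lead_coef P != 0 by rewrite lead_coef_eq0.
have rsP u : u \in rs = root P u by rewrite Ers rootZ // root_prod_XsubC.
have srs : size rs = (2 * e)%N.
  by apply: succn_inj; rewrite -sP Ers size_scale // size_prod_XsubC.
have urs : uniq rs.
  (* A multiple root of [P] would be a critical point of y, hence a root of [K]. *)
  rewrite -separable_prod_XsubC separable_poly.unlock.
  have -> : coprimep (\prod_(x <- rs) ('X - x%:P)) (\prod_(x <- rs) ('X - x%:P))^`()
      = coprimep P P^`().
    by rewrite [in RHS]Ers derivZ coprimepZl // coprimepZr.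
  apply: Pdiv.ClosedField.root_coprimep => u ru; have u0 := rootP0 _ ru.
  have /andP[_] := rootPgood _ ru; apply: contra => /eqP Pu.
  have := rootPy _ ru => yu.
  move: Pu; rewrite /P derivB derivZ derivXn hornerD hornerN hornerZ hornerMn hornerXn => /eqP.
  rewrite subr_eq0 => /eqP bu.
  rewrite /K hornerD hornerN hornerZ hornerM hornerX bu.
  have -> : b.[u] = y0 * u ^+ e by rewrite -yu divfK // expf_neq0.
  by rewrite -[in u ^+ e](prednK e_gt0) exprS -mulr_natl; apply/eqP; ring.
pose g0' := map_poly (horner_eval y0) g.
have g0'0 : g0' != 0.
  by rewrite -size_poly_eq0 size_map_poly_id0 // size_poly_eq0.
apply: (leq_trans _ (size_poly _ _ : size g0' <= size g)%N).
have := @max_poly_roots _ g0' [seq a.[u] / u ^+ e | u <- rs] g0'0.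
rewrite size_map srs => H; apply: H.
  apply/allP => x /mapP[u]; rewrite rsP => ru ->; rewrite /root.
  by rewrite -horner2_map -(rootPy _ ru) hg // rootP0.
rewrite map_inj_in_uniq // => u w; rewrite !rsP => ru rw E1.
have /andP[Ew _] := rootPgood _ rw.
by apply: injE => //; [exact: rootP0 | exact: rootP0 | rewrite (rootPy _ ru) (rootPy _ rw)].
Qed.
End DegreeLowerBound.

(** * Curves parametrized by Laurent polynomials on the unit circle *)

Section RealPart.
Variable R : realType.
Local Notation C := R[i].

(** At real points this evaluates to the real part of the value of [f], so vanishing on the real
    curve survives, as do monicity and the total degree bound. *)
Definition Re_poly2 (f : {poly {poly C}}) : {poly {poly R}} :=
  map_poly (map_poly (@complex.Re R)) f.

Lemma Re_sum (I : Type) (r : seq I) (F : I -> C) :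
  complex.Re (\sum_(i <- r) F i) = \sum_(i <- r) complex.Re (F i).
Proof. by apply: (big_morph (@complex.Re R)) => // -[x1 y1] [x2 y2]. Qed.

Lemma Re_mul_real (z : C) (x : R) : complex.Re (z * x%:C) = complex.Re z * x.
Proof. by case: z => p q /=; rewrite mulr0 subr0. Qed.

Lemma Re_poly0 : map_poly (@complex.Re R) 0 = 0.
Proof. exact: map_poly0. Qed.

Lemma horner_map_Re (q : {poly C}) (y : R) :
  (map_poly (@complex.Re R) q).[y] = complex.Re q.[y%:C].
Proof.
rewrite (horner_coef_wide _ (size_poly _ _)) horner_coef Re_sum.
by apply: eq_bigr => i _; rewrite coef_map_id0 // -Re_mul_real rmorphXn.
Qed.

Lemma horner_Re_poly2 f (x y : R) : (Re_poly2 f).[x, y] = complex.Re f.[x%:C, y%:C].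
Proof.
rewrite (horner_coef_wide _ (size_poly _ _)) [f.[_]]horner_coef !horner_sum Re_sum.
apply: eq_bigr => i _; rewrite coef_map_id0 ?Re_poly0 // -!rmorphXn !hornerM !hornerC.
by rewrite Re_mul_real horner_map_Re.
Qed.

Lemma coef_Re_poly2 f i : (Re_poly2 f)`_i = map_poly (@complex.Re R) f`_i.
Proof. by rewrite coef_map_id0 // Re_poly0. Qed.

Lemma Re_poly2_monic f : f \is monic -> Re_poly2 f \is monic /\ size (Re_poly2 f) = size f.
Proof.
move=> /monicP lf; have c1 : (Re_poly2 f)`_(size f).-1 = 1.
  rewrite coef_Re_poly2 -lead_coefE lf; apply/polyP => i.
  by rewrite coef_map_id0 // !coef1; case: (i == 0)%N.
have sf : (0 < size f)%N.
  by rewrite lt0n size_poly_eq0 -lead_coef_eq0 lf oner_neq0.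
have s : size (Re_poly2 f) = size f.
  apply/eqP; rewrite eqn_leq size_poly /= -[X in (X <= _)%N](prednK sf) ltnNge.
  by apply/negP => /(nth_default 0); rewrite c1 => /eqP; rewrite oner_eq0.
by split => //; apply/monicP; rewrite lead_coefE s.
Qed.

Lemma Re_poly2_totdeg_le d f : totdeg_le d f -> totdeg_le d (Re_poly2 f).
Proof. by move=> hf i; rewrite coef_Re_poly2 (leq_trans (size_poly _ _)) // hf. Qed.
End RealPart.

(** * Partial degrees, total degree and units *)

Section BivariateDegrees.
Variable R : realType.
Implicit Types f g h : {poly {poly R}}.

Lemma sizeY_totdeg_le d f : totdeg_le d f -> (sizeY f <= d.+1)%N.
Proof. by move=> hf; apply/bigmax_leqP => i _; rewrite (leq_trans (hf i)) // leq_subr. Qed.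

Lemma poly2_unitE h : h != 0 -> (size h <= 1)%N -> (sizeY h <= 1)%N -> h \is a GRing.unit.
Proof.
move=> h0 sh sYh.
have sh1 : size h = 1 by apply/eqP; rewrite eqn_leq sh size_poly_gt0.
have c0 : h`_0 != 0.
  by have := h0; rewrite -lead_coef_eq0 lead_coefE sh1.
have sc : size h`_0 = 1.
  by apply/eqP; rewrite eqn_leq size_poly_gt0 c0 (leq_trans (max_size_coefXY _ _)).
rewrite poly_unitE sh1 eqxx poly_unitE sc eqxx /= unitfE.
by have := c0; rewrite -lead_coef_eq0 lead_coefE sc.
Qed.

(** Partial degrees add under multiplication, so [h] has degree 0 in both variables. *)
Lemma cofactor_unit f g h : f != 0 -> f = g * h ->
  (size f <= size g)%N -> (sizeY f <= sizeY g)%N -> h \is a GRing.unit.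
Proof.
move=> f0 E; have := f0; rewrite E mulf_eq0 negb_or => /andP[g0 h0].
rewrite !sizeYE rmorphM !size_mul ?swapXY_eq0 // => s1 s2.
have p1 : (0 < size g)%N by rewrite size_poly_gt0.
have p2 : (0 < size (swapXY g))%N by rewrite size_poly_gt0 swapXY_eq0.
apply: poly2_unitE => //; rewrite ?sizeYE.
  by move: s1 p1; case: (size g) => // n; rewrite addSn /= -[n.+1]addn1 leq_add2l.
by move: s2 p2; case: (size (swapXY g)) => // n; rewrite addSn /= -[n.+1]addn1 leq_add2l.
Qed.

Lemma totdeg_le_unit h : h \is a GRing.unit -> totdeg_le 0 h.
Proof.
rewrite poly_unitE => /andP[/eqP s1]; rewrite poly_unitE => /andP[/eqP s2 _] [|i].
  by rewrite s2.
by rewrite nth_default ?s1 // size_poly0.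
Qed.

(** The bound makes the coefficient of x^d a constant, nonzero because the degree in x is d; the
    monomial x^d thus attains the total degree. *)
Lemma degrees_of_totdeg_le d f : totdeg_le d f -> (d < size f)%N -> (d < sizeY f)%N ->
  totdeg f = d /\ degx f = d /\ degy f = d.
Proof.
move=> hf sx sy.
have sfx : size f = d.+1.
  apply/eqP; rewrite eqn_leq sx andbT leqNgt; apply/negP => lt.
  have f0 : f != 0 by rewrite -size_poly_gt0 (leq_ltn_trans _ sx).
  have := hf (size f).-1; rewrite -lead_coefE.
  rewrite (_ : d.+1 - (size f).-1 = 0)%N; last first.
    by move: lt; case: (size f) => // n; rewrite ltnS -subn_eq0 => /eqP.
  by rewrite leqn0 size_poly_eq0 lead_coef_eq0 (negPf f0).
have sfy : sizeY f = d.+1 by apply/eqP; rewrite eqn_leq sy sizeY_totdeg_le.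
split; last by rewrite /degx /degy sfx sfy.
have fd : f`_d != 0.
  have <- : lead_coef f = f`_d by rewrite lead_coefE sfx.
  by rewrite lead_coef_eq0 -size_poly_eq0 sfx.
have sfd : size f`_d = 1.
  by apply/eqP; rewrite eqn_leq size_poly_gt0 fd andbT (leq_trans (hf d)) // subSnn.
apply/eqP; rewrite eqn_leq; apply/andP; split.
  apply/bigmax_leqP => i _; apply/bigmax_leqP => j _; case: ifP => // _.
  by have := leq_trans (ltn_ord j) (hf i); rewrite ltn_subRL ltnS.
have dlt : (d < size f)%N by rewrite sfx.
apply: (bigop.bigmax_sup (Ordinal dlt)) => //=.
have zlt : (0 < size (f`_d)%R)%N by rewrite sfd.
apply: (bigop.bigmax_sup (Ordinal zlt)) => //=.
rewrite addn0; have := fd; rewrite -lead_coef_eq0 lead_coefE sfd => -> //.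
Qed.
End BivariateDegrees.

(** * Vanishing on the parametrized curve *)

Section LaurentCurve.
Variable R : realType.
Local Notation C := R[i].

Definition cis (t : R) : C := cos t +i* sin t.

Lemma cis_neq0 t : cis t != 0.
Proof.
rewrite eq_complex /=; apply/negP => /andP[/eqP c0 /eqP s0].
by have := cos2Dsin2 t; rewrite c0 s0 expr0n addr0 => /eqP; rewrite eq_sym oner_eq0.
Qed.

(** The points e^(i/(n+1)) are pairwise distinct, as cos is injective on [0, pi]. *)
Lemma circle_poly_eq0 (p : {poly C}) :
  (forall t : R, - pi <= t <= pi -> p.[cis t] = 0) -> p = 0.
Proof.
move=> hp; apply/eqP; apply: contraT => p0.
have bnd (n : nat) : 0 <= (n.+1%:R^-1 : R) <= pi.
  rewrite invr_ge0 ler0n /= (@le_trans _ _ 1) ?invf_le1 ?ltr0n ?ler1n //.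
  by have := pi_ge2 R; lra.
have inj : injective (fun n : nat => cis n.+1%:R^-1).
  move=> x y [] /cos_inj; rewrite !in_itv /= !bnd => /(_ isT isT) /invr_inj /eqP.
  by rewrite eqr_nat => /eqP [].
have [n] := poly_nonroot inj p0.
by rewrite hp ?eqxx //; have /andP[h1 h2] := bnd n;
  rewrite h2 andbT (le_trans _ h1) // oppr_le0 pi_ge0.
Qed.

Section Vanishing.
Variables (a b : {poly C}) (e : nat).

Lemma laurent_clear_denominators (g : {poly {poly C}}) : exists K (G : {poly C}),
  forall u, u != 0 -> g.[a.[u] / u ^+ e, b.[u] / u ^+ e] * u ^+ K = G.[u].
Proof.
have inner (q : {poly C}) : exists K (G : {poly C}),
    forall u, u != 0 -> q.[b.[u] / u ^+ e] * u ^+ K = G.[u].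
  elim/poly_ind: q => [|q c [K [G h]]].
    by exists 0%N, 0 => u _; rewrite !horner0 mul0r.
  exists (K + e)%N, (G * b + c *: 'X^(K + e)) => u u0.
  rewrite hornerMXaddC hornerD hornerM hornerZ hornerXn -h // exprD.
  by have := expf_neq0 e u0 => ue; field.
elim/poly_ind: g => [|g q [K [G h]]].
  by exists 0%N, 0 => u _; rewrite !horner0 mul0r.
have [K' [G' h']] := inner q.
exists (K + e + K')%N, (G * a * 'X^K' + 'X^(K + e) * G') => u u0.
rewrite hornerMXaddC !hornerD !hornerM hornerC !hornerXn -h // -h' // !exprD.
by have := expf_neq0 e u0 => ue; field.
Qed.

Variables x y : R -> R.
Hypothesis xE : forall t, (x t)%:C = a.[cis t] / cis t ^+ e.
Hypothesis yE : forall t, (y t)%:C = b.[cis t] / cis t ^+ e.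

Definition complexify2 (g : {poly {poly R}}) : {poly {poly C}} :=
  map_poly (map_poly (real_complex R)) g.

Lemma horner_complexify2 g (p q : R) : (complexify2 g).[p%:C, q%:C] = (g.[p, q])%:C.
Proof. by rewrite -(map_polyC (real_complex R)) !horner_map. Qed.

Lemma size_complexify2 g : size (complexify2 g) = size g.
Proof.
apply: size_map_inj_poly; last exact: map_poly0.
by apply: map_inj_poly => //; apply: complexI.
Qed.

(** With denominators cleared, the composite is a polynomial vanishing on the unit circle, hence
    zero; this carries vanishing from real t to all complex u != 0. *)
Lemma complexify2_vanishing g :
  (forall t, - pi <= t <= pi -> g.[x t, y t] = 0) ->
  forall u, u != 0 -> (complexify2 g).[a.[u] / u ^+ e, b.[u] / u ^+ e] = 0.
Proof.
move=> hg u u0; have [K [G hG]] := laurent_clear_denominators (complexify2 g).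
apply: (mulIf (expf_neq0 K u0)); rewrite mul0r hG // (_ : G = 0) ?horner0 //.
apply: circle_poly_eq0 => t ht; rewrite -hG ?cis_neq0 // -xE -yE.
by rewrite horner_complexify2 hg // mul0r.
Qed.

(** The ideal of the curve is prime because composites with the parametrization become elements of
    the domain C[u]. *)
Lemma vanishing_prime (g h : {poly {poly R}}) :
  (forall t, - pi <= t <= pi -> (g * h).[x t, y t] = 0) ->
  (forall t, - pi <= t <= pi -> g.[x t, y t] = 0) \/
  (forall t, - pi <= t <= pi -> h.[x t, y t] = 0).
Proof.
move=> hgh; have [K [G hG]] := laurent_clear_denominators (complexify2 g).
have [L [H hH]] := laurent_clear_denominators (complexify2 h).
have back (q : {poly {poly R}}) M t :
    (complexify2 q).[a.[cis t] / cis t ^+ e, b.[cis t] / cis t ^+ e] * cis t ^+ M = 0 ->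
    q.[x t, y t] = 0.
  move=> /eqP; rewrite mulf_eq0 (negPf (expf_neq0 M (cis_neq0 t))) orbF -xE -yE.
  by rewrite horner_complexify2 => /eqP /complexI.
have : G * H = 0.
  apply: circle_poly_eq0 => t ht; rewrite hornerM -hG ?cis_neq0 // -hH ?cis_neq0 //.
  rewrite mulrACA -!xE -!yE !horner_complexify2 -rmorphM -!hornerM hgh //.
  by rewrite mul0r.
move/eqP; rewrite mulf_eq0 => /orP[/eqP G0|/eqP H0]; [left|right] => t _.
  by apply: (back _ K); rewrite hG ?cis_neq0 // G0 horner0.
by apply: (back _ L); rewrite hH ?cis_neq0 // H0 horner0.
Qed.
End Vanishing.

(** * Existence and degrees of the defining polynomial *)

Section DefiningPolynomial.
Variables (a b E : {poly C}) (e : nat) (x y : R -> R).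
Hypothesis e_gt0 : (0 < e)%N.
Hypothesis xE : forall t, (x t)%:C = a.[cis t] / cis t ^+ e.
Hypothesis yE : forall t, (y t)%:C = b.[cis t] / cis t ^+ e.
Hypotheses (a0 : a`_0 != 0) (sa : size a = (2 * e).+1).
Hypotheses (b0 : b`_0 != 0) (sb : size b = (2 * e).+1).
Hypothesis E0 : E != 0.
Hypothesis injE : forall u w, u != 0 -> w != 0 -> E.[u] != 0 ->
  a.[w] / w ^+ e = a.[u] / u ^+ e -> b.[w] / w ^+ e = b.[u] / u ^+ e -> w = u.

Let S : set (R * R) := [set q | exists2 t, - pi <= t <= pi & q = (x t, y t)].

Let vanishS (g : {poly {poly R}}) :
  (forall s, S s -> eval2 g s = 0) <-> (forall t, - pi <= t <= pi -> g.[x t, y t] = 0).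
Proof.
split=> [h t ht|h _ [t ht ->]]; last exact: h.
by apply: (h (x t, y t)); exists t.
Qed.

(** Exchanging x and y exchanges [a] and [b], so vertical lines are handled by the horizontal
    case. *)
Lemma vanishing_degrees g : g != 0 -> (forall s, S s -> eval2 g s = 0) ->
  (2 * e < size g)%N /\ (2 * e < sizeY g)%N.
Proof.
move=> g0 /vanishS hg.
have hC := complexify2_vanishing xE yE hg.
have gC0 : complexify2 g != 0 by rewrite -size_poly_eq0 size_complexify2 size_poly_eq0.
split.
  by rewrite -size_complexify2; apply: (vanishing_size_gt e_gt0 b0 sb E0 injE).
rewrite sizeYE -size_complexify2.
have sw : complexify2 (swapXY g) = swapXY (complexify2 g) by rewrite swapXY_map.
rewrite sw; apply: (@vanishing_size_gt _ b a E e) => //; rewrite ?swapXY_eq0 //.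
  by move=> u w u0 w0 Eu h1 h2; apply: injE.
by move=> u u0; rewrite horner2_swapXY hC.
Qed.

Lemma defining_poly_degrees :
  (exists f, defining_poly S f) /\
  (forall f, defining_poly S f ->
     totdeg f = (2 * e)%N /\ degx f = (2 * e)%N /\ degy f = (2 * e)%N).
Proof.
have [F0 [F0m sF0 dF0 vF0]] := implicit_equation e_gt0 b0 sb (eq_leq sa).
pose F := Re_poly2 F0.
have [Fm] := Re_poly2_monic F0m; rewrite -/F sF0 => sF.
have dF : totdeg_le (2 * e) F by apply: Re_poly2_totdeg_le.
have vF : forall s, S s -> eval2 F s = 0.
  by apply/vanishS => t _; rewrite horner_Re_poly2 xE yE vF0 ?cis_neq0.
have Fn0 : F != 0 by rewrite monic_neq0.
(* The remainder modulo the monic [F] vanishes on the curve with degree in x below 2e, so it is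
   zero. *)
have dvd g : (forall s, S s -> eval2 g s = 0) -> exists q, g = q * F.
  move=> hg; exists (Pdiv.Ring.rdivp g F).
  have := Pdiv.RingMonic.rdivp_eq Fm g; set r := Pdiv.Ring.rmodp g F => Eg.
  suff r0 : r = 0 by rewrite {1}Eg r0 addr0.
  apply/eqP; apply: contraT => rn0.
  have vr : forall s, S s -> eval2 r s = 0.
    move=> s Ss; have := hg s Ss; rewrite {1}Eg /eval2 hornerD hornerM !hornerE.
    by have := vF s Ss; rewrite /eval2 => ->; rewrite mulr0 add0r.
  have [h _] := vanishing_degrees rn0 vr.
  have := Pdiv.Ring.ltn_rmodpN0 g Fn0; rewrite -/r sF ltnS => h'.
  by have := leq_trans h h'; rewrite ltnn.
have Fnu : F \isn't a GRing.unit.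
  by rewrite poly_unitE sF eqSS gtn_eqF // muln_gt0.
have sYF : (sizeY F <= (2 * e).+1)%N by apply: sizeY_totdeg_le.
(* One factor vanishes on the curve, so its partial degrees are already at least those of [F] and
   the other factor is a unit. *)
have irrF : irreducible2 F.
  split=> //; split=> // g h Egh.
  have := Fn0; rewrite Egh mulf_eq0 negb_or => /andP[g0 h0].
  have : forall t, - pi <= t <= pi -> (g * h).[x t, y t] = 0.
    by rewrite -Egh; apply/vanishS.
  case/(vanishing_prime xE yE) => /vanishS v; [right|left].
    have [h1 h2] := vanishing_degrees g0 v.
    by apply: (cofactor_unit Fn0 Egh); rewrite ?sF // (leq_trans sYF).
  have [h1 h2] := vanishing_degrees h0 v; rewrite mulrC in Egh.
  by apply: (cofactor_unit Fn0 Egh); rewrite ?sF // (leq_trans sYF).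
split.
  exists F; split=> //; apply/seteqP; split=> q /=; last by apply.
  by move=> Fq g /dvd[k ->]; rewrite /eval2 !hornerM [X in _ * X]Fq mulr0.
move=> f [[f0 [fnu firr]] fZ].
have vf : forall s, S s -> eval2 f s = 0.
  move=> s Ss; have : zariski_closure S s by move=> g; apply.
  by rewrite -fZ.
have [h1 h2] := vanishing_degrees f0 vf.
apply: degrees_of_totdeg_le => //.
(* An irreducible multiple of the nonunit [F] is a unit times [F], and so inherits its total degree
   bound. *)
have [q Eq] := dvd f vf.
have [uq|uF] := firr _ _ Eq; last by rewrite uF in Fnu.
by rewrite Eq -[(2 * e)%N]add0n; apply: totdeg_leM => //; apply: totdeg_le_unit.
Qed.
End DefiningPolynomial.
End LaurentCurve.

(** * The rotor curve *)

(** With N = k+1, lower frequencies l give exponents N + l other than 0, N and 2N. The end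
    coefficients then come from the top frequency alone and the middle one from rho. *)
Lemma absz_shift (k : nat) (l : int) : l != 0 -> (`|l| <= k%:Z)%R ->
  [/\ (0 < absz (k.+1%:Z + l)%R)%N, (absz (k.+1%:Z + l)%R < (2 * k).+2)%N
    & absz (k.+1%:Z + l)%R != k.+1].
Proof. move=> l0 lk; split; lia. Qed.
Lemma absz_shift_le (k : nat) (l : int) : (`|l| <= k%:Z)%R -> (absz (k%:Z + l)%R <= 2 * k)%N.
Proof. lia. Qed.
Lemma shift_ge0 (k : nat) (l : int) : (`|l| <= k%:Z)%R -> 0 <= k%:Z + l.
Proof. lia. Qed.

(** * Powers of e^(it) and points of the circle *)

Section Cis.
Variable R : realType.
Implicit Types s t : R.

Lemma cisD s t : cis (s + t) = cis s * cis t.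
Proof.
apply/eqP; rewrite eq_complex /= cosD sinD eqxx /= addrC.
by apply/eqP; congr (_ + _); rewrite mulrC.
Qed.

Lemma cisMn (n : nat) t : cis (n%:R * t) = cis t ^+ n.
Proof.
elim: n => [|n IH]; first by rewrite mul0r /cis cos0 sin0 expr0.
by rewrite -natr1 mulrDl mul1r cisD IH exprSr.
Qed.

Lemma cisV t : (cis t)^-1 = cis (- t).
Proof.
apply: (mulfI (cis_neq0 t)); rewrite mulfV ?cis_neq0 // -cisD subrr.
by rewrite /cis cos0 sin0.
Qed.

Lemma cisM_shift (k : nat) (l : int) t : (0 <= k%:Z + l) ->
  cis t ^+ absz (k%:Z + l) = cis t ^+ k * cis (l%:~R * t).
Proof.
move=> h; rewrite -!cisMn -cisD; congr cis; rewrite -mulrDl; congr (_ * _).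
by rewrite -[LHS]/(((absz (k%:Z + l))%:Z)%:~R) gez0_abs // rmorphD.
Qed.

Lemma circle_point (c s : R) : c ^+ 2 + s ^+ 2 = 1 ->
  exists2 t, - pi <= t <= pi & cos t = c /\ sin t = s.
Proof.
move=> cs.
have c1 : -1 <= c <= 1.
  by rewrite -ler_norml -sqrtr_sqr -[1]sqrtr1 ler_sqrt //; have := sqr_ge0 s; lra.
have sc : sin (acos c) = `|s|.
  by rewrite sin_acos // -sqrtr_sqr; congr Num.sqrt; lra.
have [h0 hp] := (acos_ge0 c1, acos_lepi c1).
have [s0|s0] := lerP 0 s.
  exists (acos c); first by rewrite hp (le_trans _ h0) // oppr_le0 pi_ge0.
  by rewrite acosK // sc ger0_norm.
exists (- acos c).
  by rewrite lerN2 hp /= (@le_trans _ _ 0) ?oppr_le0 ?pi_ge0.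
by rewrite cosN acosK // sinN sc ltr0_norm // opprK.
Qed.
End Cis.

(** * Trigonometric polynomials and their derivatives *)

Section TrigPoly.
Variables (R : realType) (rho : R) (a b : int -> R).
Local Notation C := R[i].

Definition trig_term (l : int) (t : R) : R :=
  a l * cos (l%:~R * t) + b l * sin (l%:~R * t).

Definition trig_term' (l : int) (t : R) : R :=
  l%:~R * (b l * cos (l%:~R * t) - a l * sin (l%:~R * t)).

Lemma is_derive_trig_term (l : int) (t : R) : is_derive t 1 (trig_term l) (trig_term' l t).
Proof.
have dl : is_derive t 1 (fun t : R => l%:~R * t) l%:~R.
  by apply: is_derive_eq; exact: mulr1.
have dc := is_derive1_comp (is_derive_cos (l%:~R * t)) dl.
have ds := is_derive1_comp (is_derive_sin (l%:~R * t)) dl.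
have := is_deriveD (is_deriveZ (a l) dc) (is_deriveZ (b l) ds).
move=> d; apply: (is_derive_eq d).
rewrite /trig_term' /GRing.scale /=; ring.
Qed.

Lemma is_derive_trig_sum (s : seq int) (t : R) :
  is_derive t 1 (fun t => rho + \sum_(l <- s) trig_term l t) (\sum_(l <- s) trig_term' l t).
Proof.
elim: s => [|l s IH].
  rewrite big_nil (_ : (fun _ => _) = cst rho); first exact: is_derive_cst.
  by apply/funext => x /=; rewrite big_nil addr0.
rewrite big_cons (_ : (fun _ => _) = trig_term l + (fun t => rho + \sum_(l <- s) trig_term l t)).
  exact: is_deriveD (is_derive_trig_term l t) IH.
by apply/funext => x /=; rewrite big_cons addrCA.
Qed.
End TrigPoly.

(** * Numerators of z and of its conjugate *)

Section RotorPoly.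
Variables (R : realType) (rho : R) (a b : int -> R) (k : nat) (s : seq int).
Local Notation C := R[i].
Local Notation N := (k.+1%:Z).
Hypothesis s_bound : forall l, l \in s -> l != 0 /\ (`|l| <= k%:Z)%R.

(** The coefficient c for which a cos(lt) + b sin(lt) = c u^l + conj(c) u^(-l). *)
Definition fourier_coef (l : int) : C := (a l / 2) +i* (- (b l / 2)).

(* For p = rho + sum of the frequencies N :: s and sigma = 1, -1, the value at
   u = e^(it) is u^(k+1) (p(t) + i sigma p'(t)). *)
Definition rotor_monomials (sigma : R) (l : int) : {poly C} :=
  ((1 - sigma * l%:~R)%:C * fourier_coef l) *: 'X^(absz (N + l))
  + ((1 + sigma * l%:~R)%:C * conjc (fourier_coef l)) *: 'X^(absz (N - l)).

Definition rotor_poly (sigma : R) : {poly C} :=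
  rho%:C *: 'X^(k.+1) + \sum_(l <- N :: s) rotor_monomials sigma l.

Lemma horner_rotor_monomials sigma l t : (`|l| <= N)%R ->
  (rotor_monomials sigma l).[cis t] =
  cis t ^+ k.+1 * (trig_term a b l t +i* (sigma * trig_term' a b l t)).
Proof.
move=> hl; rewrite hornerD !hornerZ !hornerXn !cisM_shift ?shift_ge0 ?normrN //.
rewrite ![_ * (cis t ^+ _ * _)]mulrCA -mulrDr; congr (_ * _).
rewrite mulrNz mulNr /cis cosN sinN /fourier_coef /trig_term /trig_term'.
move: (l%:~R : R) => r; set c := cos _; set d := sin _.
by apply/eqP; rewrite eq_complex /=; apply/andP; split; apply/eqP; field.
Qed.

Lemma horner_rotor_poly sigma t :
  (rotor_poly sigma).[cis t] = cis t ^+ k.+1 *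
   ((rho + \sum_(l <- N :: s) trig_term a b l t)
      +i* (sigma * \sum_(l <- N :: s) trig_term' a b l t)).
Proof.
rewrite hornerD hornerZ hornerXn horner_sum mulrC.
have -> : \sum_(l <- N :: s) (rotor_monomials sigma l).[cis t] =
  \sum_(l <- N :: s) cis t ^+ k.+1 * (trig_term a b l t +i* (sigma * trig_term' a b l t)).
  rewrite big_seq [RHS]big_seq; apply: eq_bigr => l; rewrite inE => /orP[/eqP ->|/s_bound[_ h]].
    by apply: horner_rotor_monomials; rewrite ger0_norm.
  by apply: horner_rotor_monomials; apply: le_trans h _; rewrite lez_nat.
rewrite -mulr_sumr -mulrDr; congr (_ * _); rewrite mulr_sumr.
elim: (N :: s) => [|l r IH]; first by rewrite !big_nil !addr0.
rewrite !big_cons addrCA IH; apply/eqP; rewrite eq_complex /= eqxx andbT.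
by rewrite addrCA.
Qed.

Lemma coef_rotor_monomials_eq0 sigma l j : l \in s ->
  (j == 0) || (j == k.+1) || (j == (2 * k).+2) ->
  (rotor_monomials sigma l)`_j = 0.
Proof.
move=> /s_bound[l0 lk] hj.
have [p1 p2 p3] := absz_shift l0 lk.
have [n1 n2 n3] : [/\ (0 < absz (N - l)%R)%N, (absz (N - l)%R < (2 * k).+2)%N
    & absz (N - l)%R != k.+1] by apply: absz_shift; rewrite ?oppr_eq0 ?normrN.
rewrite coefD !coefZ !coefXn.
suff [-> ->] : (j == absz (N + l)%R) = false /\ (j == absz (N - l)%R) = false.
  by rewrite !mulr0 addr0.
by case/orP: hj => [/orP[]|] /eqP ->; rewrite ?(ltn_eqF p1) ?(ltn_eqF n1)
  ?(gtn_eqF p2) ?(gtn_eqF n2) // ![_ == absz _]eq_sym (negPf p3) (negPf n3).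
Qed.

Lemma coef_rotor_poly sigma j : (j == 0) || (j == k.+1) || (j == (2 * k).+2) ->
  (rotor_poly sigma)`_j = rho%:C * (j == k.+1)%:R + (rotor_monomials sigma N)`_j.
Proof.
move=> hj; rewrite coefD coefZ coefXn coef_sum big_cons big_seq big1 ?addr0 // => l ls.
exact: coef_rotor_monomials_eq0.
Qed.

Lemma coef_rotor_poly_end sigma : (rotor_poly sigma)`_0 =
  (1 + sigma * k.+1%:R)%:C * conjc (fourier_coef N).
Proof.
rewrite coef_rotor_poly // mulr0 add0r.
by rewrite coefD !coefZ !coefXn subrr /= mulr1 mulr0 add0r.
Qed.

Lemma coef_rotor_poly_lead sigma : (rotor_poly sigma)`_(2 * k).+2 =
  (1 - sigma * k.+1%:R)%:C * fourier_coef N.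
Proof.
rewrite coef_rotor_poly ?eqxx ?orbT // (_ : (_ == k.+1) = false); last first.
  by apply/negbTE; clear; lia.
rewrite mulr0 add0r coefD !coefZ !coefXn subrr mulr0 addr0.
by rewrite (_ : (_ == _) = true) ?mulr1 //; apply/eqP; clear; lia.
Qed.

Lemma coef_rotor_poly_mid sigma : (rotor_poly sigma)`_(k.+1) = rho%:C.
Proof.
rewrite coef_rotor_poly ?eqxx ?orbT // mulr1 coefD !coefZ !coefXn subrr.
rewrite (_ : (k.+1 == absz (N + N)%R) = false); last by apply/negbTE; clear; lia.
by rewrite !mulr0 !addr0.
Qed.

Lemma size_rotor_poly_le sigma : (size (rotor_poly sigma) <= (2 * k).+3)%N.
Proof.
have kE : (2 * k).+2 = (2 * k.+1)%N by clear; lia.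
rewrite (leq_trans (size_polyD _ _)) // geq_max; apply/andP; split.
  by rewrite (leq_trans (size_scale_leq _ _)) // size_polyXn kE ltnS leq_pmull.
rewrite big_seq; elim/big_ind: _ => [|p q hp hq|l hl].
- by rewrite size_poly0.
- by rewrite (leq_trans (size_polyD _ _)) // geq_max hp.
have {}hl : (`|l| <= N)%R.
  move: hl; rewrite inE => /orP[/eqP ->|/s_bound[_ h]]; first by rewrite ger0_norm.
  by apply: le_trans h _; rewrite lez_nat.
rewrite (leq_trans (size_polyD _ _)) // geq_max; apply/andP; split;
  rewrite (leq_trans (size_scale_leq _ _)) // size_polyXn ltnS kE; apply: absz_shift_le => //.
by rewrite normrN.
Qed.

(** The end coefficients carry the factors 1 + sigma N and 1 - sigma N, whose product 1 - N^2 is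
    nonzero since N >= 2. *)
Lemma rotor_poly_ends sigma : sigma ^+ 2 = 1 -> (0 < k)%N ->
  a N != 0 \/ b N != 0 ->
  (rotor_poly sigma)`_0 != 0 /\ size (rotor_poly sigma) = (2 * k).+3.
Proof.
move=> s1 k0 ab.
have c0 : fourier_coef N != 0.
  rewrite eq_complex /= oppr_eq0 !mulf_eq0 invr_eq0 pnatr_eq0 /= !orbF negb_and.
  by apply/orP.
have nz : 1 - (k.+1%:R : R) ^+ 2 != 0.
  by rewrite -natrX subr_eq0 (eqr_nat R 1) ltn_eqF // -[1%N](exp1n 2) ltn_exp2r.
have [n1 n2] : 1 + sigma * k.+1%:R != 0 /\ 1 - sigma * k.+1%:R != 0.
  apply/andP; rewrite -negb_or -mulf_eq0.
  rewrite (_ : _ * _ = 1 - k.+1%:R ^+ 2) //.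
  by transitivity (1 - sigma ^+ 2 * k.+1%:R ^+ 2); [ring | rewrite s1 mul1r].
split.
  rewrite coef_rotor_poly_end mulf_neq0 ?conjc_eq0 //.
  by rewrite eq_complex /= eqxx andbT.
apply/eqP; rewrite eqn_leq size_rotor_poly_le /= ltnNge; apply/negP => /(nth_default 0).
rewrite coef_rotor_poly_lead => /eqP; apply/negP; rewrite mulf_neq0 //.
by rewrite eq_complex /= eqxx andbT.
Qed.
End RotorPoly.

(** * Curves of trigonometric polynomials with a dominant frequency *)

Section TrigCurve.
Variables (R : realType) (rho : R) (a b : int -> R) (k : nat) (s : seq int).
Local Notation C := R[i].
Local Notation N := (k.+1%:Z).
Hypothesis s_bound : forall l, l \in s -> l != 0 /\ (`|l| <= k%:Z)%R.
Hypotheses (k_gt0 : (0 < k)%N) (rho0 : rho != 0) (abN : a N != 0 \/ b N != 0).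

Let p (t : R) := rho + \sum_(l <- N :: s) trig_term a b l t.

Lemma trig_curve_degrees :
  (exists f, defining_poly (rotor_curve p) f) /\
  (forall f, defining_poly (rotor_curve p) f ->
     totdeg f = (2 * k.+2)%N /\ degx f = (2 * k.+2)%N /\ degy f = (2 * k.+2)%N).
Proof.
pose f := rotor_poly rho a b k s 1; pose h := rotor_poly rho a b k s (-1).
have [f0 sf] : f`_0 != 0 /\ size f = (2 * k).+3.
  by apply: rotor_poly_ends; rewrite ?expr1n.
have [h0 sh] : h`_0 != 0 /\ size h = (2 * k).+3.
  by apply: rotor_poly_ends; rewrite ?sqrrN ?expr1n.
have fk : f`_k.+1 != 0.
  by rewrite coef_rotor_poly_mid // eq_complex /= eqxx andbT.
have [E E0 injE] := generic_injectivity k_gt0 f0 h0 sf sh fk.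
pose i := 'i%C : C.
have i2 : i ^+ 2 = -1 by exact: sqr_i.
have i0 : i != 0 by rewrite -sqrf_eq0 i2 oppr_eq0 oner_eq0.
have two0 : 2%:R != 0 :> C by rewrite pnatr_eq0.
(* Over the common denominator u^(k+2), z = u^2 f and w = h, while x = (z + w)/2 and y = (z -
   w)/(2i). Constant terms come from [h], leading terms from X^2 [f]. *)
pose pa := 2%:R^-1 *: ('X^2 * f + h); pose pb := (2%:R * i)^-1 *: ('X^2 * f - h).
have fn0 : f != 0 by rewrite -size_poly_eq0 sf.
have sX : size ('X^2 * f) = (2 * k.+2).+1.
  by rewrite size_monicM ?monicXn // size_polyXn sf !mulnS.
have paE u : pa.[u] = (u ^+ 2 * f.[u] + h.[u]) / 2%:R.
  by rewrite hornerZ hornerD hornerM hornerXn mulrC.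
have pbE u : pb.[u] = (u ^+ 2 * f.[u] - h.[u]) / (2%:R * i).
  by rewrite hornerZ hornerD hornerN hornerM hornerXn mulrC.
have dp t : derive1 p t = \sum_(l <- N :: s) trig_term' a b l t.
  rewrite derive1E; exact: (@derive_val _ _ _ _ _ _ _ (is_derive_trig_sum rho a b (N :: s) t)).
have fE t : f.[cis t] = cis t ^+ k.+1 * (p t +i* derive1 p t).
  by rewrite horner_rotor_poly // mul1r dp.
have hE t : h.[cis t] = cis t ^+ k.+1 * (p t +i* (- derive1 p t)).
  by rewrite horner_rotor_poly // mulN1r dp.
apply: (@defining_poly_degrees R pa pb E k.+2
   (fun t => p t * cos t - derive1 p t * sin t) (fun t => p t * sin t + derive1 p t * cos t)) => //.
- move=> t; rewrite paE fE hE; have u0 := cis_neq0 t.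
  transitivity ((cis t * (p t +i* derive1 p t) + (cis t)^-1 * (p t +i* (- derive1 p t))) / 2%:R).
    rewrite cisV /cis cosN sinN; apply: (mulIf two0); rewrite divfK // mulr_natr mulr2n.
    by apply/eqP; rewrite eq_complex /=; apply/andP; split; apply/eqP; ring.
  rewrite (exprS _ k.+1); move: (expf_neq0 k.+1 u0); move: (cis t ^+ k.+1) => v v0.
  by field; rewrite ?u0 ?v0 ?i0 ?two0.
- move=> t; rewrite pbE fE hE; have u0 := cis_neq0 t.
  transitivity ((cis t * (p t +i* derive1 p t) - (cis t)^-1 * (p t +i* (- derive1 p t)))
                  / (2%:R * i)).
    rewrite cisV /cis cosN sinN; apply: (mulIf (mulf_neq0 two0 i0)); rewrite divfK ?mulf_neq0 //.
    rewrite mulrCA mulr_natl mulr2n.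
    by apply/eqP; rewrite eq_complex /=; apply/andP; split; apply/eqP; ring.
  rewrite (exprS _ k.+1); move: (expf_neq0 k.+1 u0); move: (cis t ^+ k.+1) => v v0.
  by field; rewrite ?u0 ?v0 ?i0 ?two0.
- by rewrite coefZ mulf_neq0 ?invr_eq0 // coefD coefXnM /= add0r.
- by rewrite size_scale ?invr_eq0 // size_polyDl // sX sh !mulnS leqnSn.
- by rewrite coefZ mulf_neq0 ?invr_eq0 ?mulf_neq0 // coefB coefXnM /= sub0r oppr_eq0.
- by rewrite size_scale ?invr_eq0 ?mulf_neq0 // size_polyDl // size_polyN sX sh !mulnS leqnSn.
move=> u w u0 w0 Eu; rewrite !paE !pbE => ea eb.
(* Recovers z = x + iy and then w = x - iy, so that equal x and y give the equations of [injE]. *)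
have sumE (A B W : C) : W != 0 -> A / W = (A + B) / 2%:R / W + i * ((A - B) / (2%:R * i) / W).
  by move=> W0; field; rewrite ?W0 ?i0 ?two0.
have difE (A B W : C) : W != 0 -> B / W = (A + B) / 2%:R / W - i * ((A - B) / (2%:R * i) / W).
  by move=> W0; field; rewrite ?W0 ?i0 ?two0.
apply: injE => //; apply/eqP; rewrite -eqr_div ?expf_neq0 //; apply/eqP.
  have := sumE (w ^+ 2 * f.[w]) h.[w] _ (expf_neq0 k.+2 w0).
  rewrite ea eb -sumE ?expf_neq0 // -[k.+2]add2n !exprD -!mulf_div !mulfV ?expf_neq0 //.
  by rewrite !mul1r.
have := difE (w ^+ 2 * f.[w]) h.[w] _ (expf_neq0 k.+2 w0).
by rewrite ea eb -difE ?expf_neq0.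
Qed.
End TrigCurve.

(** * Frequencies of a rotor and the degree formula *)

(** For m = 0 the frequencies are 1 and -1, and p = rho + A cos t + B sin t is the support function
    of the circle of radius rho centred at (A, B). *)
Lemma rotor_p_circle (R : realType) (n : nat) (rho : R) (a b : int -> R) :
  0 < rho -> is_circle (rotor_curve (rotor_p n 0 rho a b)).
Proof.
move=> rho0; set A := a 1 + a (-1); set B := b 1 - b (-1).
pose q := fun t : R => rho + \sum_(l <- [:: 1; -1]) trig_term a b l t.
have -> : rotor_p n 0 rho a b = q.
  apply/funext => t; rewrite /q /rotor_p big_ord_recr big_ord0 /= !big_cons big_nil.
  by rewrite /trig_term mul0n add0r addr0 !add0r !addrA.
have qE t : q t = rho + A * cos t + B * sin t.
  rewrite /q !big_cons big_nil /trig_term mulrN1z mulN1r mulr1z mul1r cosN sinN /A /B; ring.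
have dq t : derive1 q t = B * cos t - A * sin t.
  rewrite derive1E.
  rewrite (@derive_val _ _ _ _ _ _ _ (is_derive_trig_sum rho a b [:: 1; -1] t)).
  rewrite !big_cons big_nil /trig_term' mulrN1z mulr1z !mulN1r !mul1r cosN sinN /A /B; ring.
have xE t : q t * cos t - derive1 q t * sin t = rho * cos t + A.
  rewrite qE dq -[A in RHS]mulr1 -(cos2Dsin2 t); ring.
have yE t : q t * sin t + derive1 q t * cos t = rho * sin t + B.
  rewrite qE dq -[B in RHS]mulr1 -(cos2Dsin2 t); ring.
exists A, B, rho; split=> //; apply/seteqP; split=> [_ [t _ ->]|[x y]] /=.
  rewrite xE yE !addrK !exprMn -mulrDr cos2Dsin2 mulr1 //.
move=> h; have rn0 : rho != 0 by rewrite gt_eqF.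
have [|t ht [ct st]] := @circle_point R ((x - A) / rho) ((y - B) / rho).
  by rewrite !exprMn -mulrDl h -exprMn mulfV // expr1n.
exists t => //; rewrite xE yE ct st; congr (_, _).
  by rewrite mulrC divfK // subrK.
by rewrite mulrC divfK // subrK.
Qed.

(** The frequencies below the top one mn + 1, which is kept apart because it determines the
    degree. *)
Definition rotor_frequencies (n m : nat) : seq int :=
  ((m * n)%:Z - 1) ::
    flatten [seq [:: (j * n)%:Z + 1; (j * n)%:Z - 1] | j <- iota 0 m].

(** As n >= 3, the multiple jn is 0 or at least 3, so jn + 1 and jn - 1 are nonzero; for j < m they
    stay below mn. *)
Lemma rotor_frequencies_bound n m l : (3 <= n)%N -> (0 < m)%N ->
  l \in rotor_frequencies n m -> l != 0 /\ `|l| <= (m * n)%:Z.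
Proof.
move=> n3 m0; rewrite inE => /orP[/eqP ->|/flatten_mapP[j]].
  have h : (3 <= m * n)%N by rewrite (leq_trans n3) // leq_pmull.
  by move: (m * n)%N h => q h; clear -h; split; lia.
rewrite mem_iota add0n /= => jm.
have h : (j * n + 3 <= m * n)%N.
  rewrite (@leq_trans (j.+1 * n)) ?leq_mul2r ?jm ?orbT //.
  by rewrite mulSn addnC leq_add2r.
have h2 : (j * n == 0)%N || (3 <= j * n)%N.
  by case: j {jm h} => // j; rewrite mulSn (leq_trans n3) ?orbT // leq_addr.
move: (m * n)%N (j * n)%N h h2 => p q h h2.
by rewrite !inE => /orP[] /eqP ->; clear -h h2; split; lia.
Qed.

Lemma rotor_pE (R : realType) n m (rho : R) (a b : int -> R) :
  rotor_p n m rho a b = fun t =>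
    rho + \sum_(l <- (m * n).+1%:Z :: rotor_frequencies n m) trig_term a b l t.
Proof.
apply/funext => t; congr (_ + _); rewrite !big_cons big_flatten big_map /=.
rewrite -[(m * n).+1]addn1 PoszD big_ord_recr /= [RHS]addrA addrC.
congr (_ + _); first by rewrite /trig_term !addrA.
have -> : iota 0 m = index_iota 0 m by rewrite /index_iota subn0.
rewrite big_mkord.
by apply: eq_bigr => j _; rewrite !big_cons big_nil addr0 /trig_term !addrA.
Qed.

Theorem theorem2p8 (R : realType) (n m : nat) (rho : R) (a b : int -> R) :
  (3 <= n)%N -> 0 < rho ->
  (forall t : R, 0 <= rotor_p n m rho a b t
                      + derive1 (derive1 (rotor_p n m rho a b)) t) ->
  ~ is_circle (rotor_curve (rotor_p n m rho a b)) ->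
  (a ((m * n)%:Z + 1) != 0 \/ b ((m * n)%:Z + 1) != 0) ->
  (exists f, defining_poly (rotor_curve (rotor_p n m rho a b)) f) /\
  (forall f, defining_poly (rotor_curve (rotor_p n m rho a b)) f ->
     totdeg f = (2 * n * m + 4)%N /\
     degx f = (2 * n * m + 4)%N /\ degy f = (2 * n * m + 4)%N).
Proof.
move=> n3 rho0 _ ncircle abN.
have m0 : (0 < m)%N.
  rewrite lt0n; apply/eqP => m0; apply: ncircle; rewrite m0.
  exact: rotor_p_circle.
have -> : (2 * n * m + 4 = 2 * (m * n).+2)%N by rewrite -mulnA [(n * m)%N]mulnC !mulnS addnC.
rewrite rotor_pE; apply: trig_curve_degrees.
- by move=> l; apply: rotor_frequencies_bound.
- by rewrite muln_gt0 m0 (leq_trans _ n3).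
- by rewrite gt_eqF.
- by rewrite -[(m * n).+1]addn1 PoszD.
Qed.
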